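(* Let $\lambda_1,\dots,\lambda_4\in\mathbb{R}$ be pairwise distinct constants and consider the system for functions $u,v$ of $(x^1,x^2,x^3,x^4)$ $$ \begin{aligned} &(\lambda_3-\lambda_4)(\lambda_1-\lambda_2)v_1u_2u_{34}+(\lambda_2-\lambda_3)(\lambda_1-\lambda_4)(v_1u_4u_{23}-v_3u_4u_{12}+v_3u_2u_{14})\\ &\quad-(\lambda_2-\lambda_4)(\lambda_1-\lambda_3)(v_1u_3u_{24}-v_4u_3u_{12}+v_4u_2u_{13})=0,\\ &(\lambda_3-\lambda_4)(\lambda_1-\lambda_2)v_1u_2v_{34}+(\lambda_2-\lambda_3)(\lambda_1-\lambda_4)(v_1u_4v_{23}-v_3u_4v_{12}+v_3u_2v_{14})\\ &\quad-(\lambda_2-\lambda_4)(\lambda_1-\lambda_3)(v_1u_3v_{24}-v_4u_3v_{12}+v_4u_2v_{13})=0 \end{aligned}\qquad (S) $$ (with $u_2v_1\neq0$). Let $\xi_r^j$, $j=1,2$, $r=0,1,2,\dots$, be the nonlocal variables over (S) defined by $$[Q_0,X_i^{(0)}]=0,\qquad [Q_r,X_i^{(0)}]=[Q_{r-1},X_i^{(1)}]\quad (r=1,2,\dots),\qquad i=0,1,$$ where $Q_r=\xi_r^1\partial_{x^1}+\xi_r^2\partial_{x^2}$ and the vector fields $X_i^{(0)},X_i^{(1)}$ are those given in the context. Then the flows $$u_{\tau_r}=\xi_r^2u_2,\qquad v_{\tau_r}=-\xi_r^1v_1,\qquad r=0,1,2,\dots,$$ are compatible with (S), and thus define an infinite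 hierarchy of nonlocal symmetries for (S) with the characteristics $(\xi_r^2u_2,-\xi_r^1v_1)$, $r=0,1,2,\dots$.
   Context: Subscripts $i,j\in\{1,2,3,4\}$ on $u,v$ denote partial derivatives with respect to $x^i$; $[\cdot,\cdot]$ is the Lie bracket of vector fields. Define $$ \begin{aligned} X_0&=(\lambda-\lambda_1)\frac{\lambda_2-\lambda_4}{\lambda_1-\lambda_2}\frac{v_4}{v_1}\partial_{x^1}-(\lambda-\lambda_2)\frac{\lambda_1-\lambda_4}{\lambda_1-\lambda_2}\frac{u_4}{u_2}\partial_{x^2}+(\lambda-\lambda_4)\partial_{x^4},\\ X_1&=(\lambda-\lambda_1)\frac{\lambda_2-\lambda_3}{\lambda_1-\lambda_2}\frac{v_3}{v_1}\partial_{x^1}-(\lambda-\lambda_2)\frac{\lambda_1-\lambda_3}{\lambda_1-\lambda_2}\frac{u_3}{u_2}\partial_{x^2}+(\lambda-\lambda_3)\partial_{x^3}, \end{aligned} $$ and let $X_i^{(0)},X_i^{(1)}$ be the $\lambda$-independent vector fields determined by $X_i=X_i^{(0)}-\lambda X_i^{(1)}$, $i=0,1$. (One has $[X_0,X_1]=0$ for all $\lambda$ when (S) holds.) The defining relations for $\xi_r^j$ are the coefficients in powers of $\lambda$ of $[Q,X_i]=0$, $i=0,1$, for $Q=\xi^1\partial_{x^1}+\xi^2\partial_{x^2}$, $\xi^j=\sum_{r\ge0}\xi^j_r\lambda^r$; they can be solved for the derivatives $\partial\xi^j_r/\partial x^m$, $m=3,4$, and so define a differential covering over (S) with the nonlocal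 variables $\xi_r^j$. A nonlocal symmetry of (S) with characteristic $(U,V)$ means here a pair of functions $U,V$ of the independent variables, of $u,v$ and their derivatives, and of nonlocal variables over (S) and their derivatives, satisfying the linearization of (S), i.e. $\frac{d}{d\varepsilon}\big|_{\varepsilon=0}F^k[u+\varepsilon U,v+\varepsilon V]=0$, $k=1,2$ (where $F^1[u,v]=0$, $F^2[u,v]=0$ are the two equations of (S) and derivatives of $U,V$ are total derivatives), modulo (S), the equations defining the nonlocal variables, and differential consequences of these. Compatibility of the flow $u_\tau=U$, $v_\tau=V$ with (S) means the same thing. *)

(* Defs.v *)
From HB Require Import structures.
From mathcomp Require Import all_boot all_order all_algebra.
From mathcomp Require Import all_classical all_reals all_analysis.
From mathcomp Require Import ring.
Set Implicit Arguments.
Unset Strict Implicit.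
Unset Printing Implicit Defensive.
Import Order.TTheory GRing.Theory Num.Theory.
Import numFieldNormedType.Exports.
Local Open Scope classical_set_scope.
Local Open Scope ring_scope.

(* The index of the independent variable x^k is the ordinal k - 1. *)
Definition x1 : 'I_4 := @Ordinal 4 0 isT.
Definition x2 : 'I_4 := @Ordinal 4 1 isT.
Definition x3 : 'I_4 := @Ordinal 4 2 isT.
Definition x4 : 'I_4 := @Ordinal 4 3 isT.

Definition multi_index := {ffun 'I_4 -> nat}.

Definition incr (i : 'I_4) (al : multi_index) : multi_index :=
  [ffun k => (al k + (k == i))%N].

Inductive unknown :=
  | unk_u
  | unk_v
  | unk_xi1 of nat
  | unk_xi2 of nat.

(* Coordinates on the space of infinite jets: the x^i, and one coordinate
   [Jet w al] for each unknown w and each derivative of w of multi-index al.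
   The nonlocal variables are unknowns like u and v: their x^3- and
   x^4-derivatives are only constrained on the subset [covering] below. *)
Inductive coordinate :=
  | Indep of 'I_4
  | Jet of unknown & multi_index.

Definition jet_space (R : realType) := coordinate -> R.

Definition jet_function (R : realType) := jet_space R -> R.

Definition unknown_fun (R : realType) (w : unknown) : jet_function R :=
  fun p => p (Jet w [ffun=> 0%N]).

Definition u {R : realType} : jet_function R := unknown_fun unk_u.
Definition v {R : realType} : jet_function R := unknown_fun unk_v.
Definition xi1 {R : realType} (r : nat) : jet_function R :=
  unknown_fun (unk_xi1 r).
Definition xi2 {R : realType} (r : nat) : jet_function R :=
  unknown_fun (unk_xi2 r).

(* Value at p of the vector field
     D_i = d/dx^i + \sum_(w, al) w_(al + 1_i) d/dw_al
   on the jet space. *)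
Definition total_vector (R : realType) (i : 'I_4) (p : jet_space R) :
    jet_space R :=
  fun c => match c with
           | Indep k => (k == i)%:R
           | Jet w al => p (Jet w (incr i al))
           end.

(* Total derivative D_i f: the derivative of f along [total_vector i]. For a
   smooth function of finitely many coordinates this is the usual finite sum
   of partial derivatives. *)
Definition Dx (R : realType) (i : 'I_4) (f : jet_function R) : jet_function R :=
  fun p => derive1 (fun t : R => f (fun c => p c + t * total_vector i p c)) 0.

Lemma Dx_jet (R : realType) (i : 'I_4) (w : unknown) (al : multi_index)
    (p : jet_space R) :
  Dx i (fun q => q (Jet w al)) p = p (Jet w (incr i al)).
Proof.
rewrite /Dx derive1E /=.
set a := p (Jet w al); set b := p _.
have -> : (fun t : R => a + t * b) = cst a + (id \* cst b) by exact/funext.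
have H : is_derive (0 : R) 1 (cst a + (id \* cst b)) b.
  apply: (is_derive_eq (is_deriveD _ _)).
  by rewrite scaler0 add0r add0r -[LHS]/(b * 1) mulr1.
exact: (@derive_val _ _ _ _ _ _ _ H).
Qed.

Definition Dxs (R : realType) (s : seq 'I_4) (f : jet_function R) :
    jet_function R :=
  foldr (@Dx R) f s.

Definition vector_field (R : realType) := 'I_4 -> jet_function R.

(* On jet functions the partial derivative d/dx^a of the coordinate expression
   of the Lie bracket is the total derivative D_a. *)
Definition bracket (R : realType) (X Y : vector_field R) : vector_field R :=
  fun b p => \sum_(a < 4) (X a p * Dx a (Y b) p - Y a p * Dx a (X b) p).

(* The left-hand side of the first equation of (S) is [S_op f g f] and that of
   the second one is [S_op f g g], at u = f and v = g. *)
Definition S_op (R : realType) (lam : 'I_4 -> R) (f g w : jet_function R) :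
    jet_function R :=
  fun p =>
    (lam x3 - lam x4) * (lam x1 - lam x2) *
      (Dx x1 g p * Dx x2 f p * Dx x3 (Dx x4 w) p)
  + (lam x2 - lam x3) * (lam x1 - lam x4) *
      (Dx x1 g p * Dx x4 f p * Dx x2 (Dx x3 w) p
       - Dx x3 g p * Dx x4 f p * Dx x1 (Dx x2 w) p
       + Dx x3 g p * Dx x2 f p * Dx x1 (Dx x4 w) p)
  - (lam x2 - lam x4) * (lam x1 - lam x3) *
      (Dx x1 g p * Dx x3 f p * Dx x2 (Dx x4 w) p
       - Dx x4 g p * Dx x3 f p * Dx x1 (Dx x2 w) p
       + Dx x4 g p * Dx x2 f p * Dx x1 (Dx x3 w) p).

Definition S1 (R : realType) (lam : 'I_4 -> R) (f g : jet_function R) :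
  jet_function R := S_op lam f g f.

Definition S2 (R : realType) (lam : 'I_4 -> R) (f g : jet_function R) :
  jet_function R := S_op lam f g g.

(* [pencil lam x4 l] is X_0 and [pencil lam x3 l] is X_1, at the value l of
   the spectral parameter. *)
Definition pencil (R : realType) (lam : 'I_4 -> R) (m : 'I_4) (l : R) :
    vector_field R :=
  fun a p =>
    if a == x1 then
      (l - lam x1) * ((lam x2 - lam m) / (lam x1 - lam x2)) *
        (Dx m v p / Dx x1 v p)
    else if a == x2 then
      - ((l - lam x2) * ((lam x1 - lam m) / (lam x1 - lam x2)) *
        (Dx m u p / Dx x2 u p))
    else if a == m then l - lam m
    else 0.

Definition X (R : realType) (lam : 'I_4 -> R) (i : 'I_2) (l : R) :
    vector_field R :=
  pencil lam (if i == 0 :> nat then x4 else x3) l.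

(* X_i^(0) and X_i^(1). *)
Definition Xcoef0 (R : realType) (lam : 'I_4 -> R) (i : 'I_2) : vector_field R :=
  X lam i 0.

Definition Xcoef1 (R : realType) (lam : 'I_4 -> R) (i : 'I_2) : vector_field R :=
  fun a p => X lam i 0 a p - X lam i 1 a p.

Lemma X_affine (R : realType) (lam : 'I_4 -> R) (i : 'I_2) (l : R) (a : 'I_4)
    (p : jet_space R) :
  X lam i l a p = Xcoef0 lam i a p - l * Xcoef1 lam i a p.
Proof.
rewrite /Xcoef1 /Xcoef0 /X; set m := if _ then _ else _.
by rewrite /pencil; case: (a == x1); case: (a == x2); case: (a == m); ring.
Qed.

Definition Q {R : realType} (r : nat) : vector_field R :=
  fun a p => if a == x1 then xi1 r p else if a == x2 then xi2 r p else 0.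

Definition nonlocal_eq (R : realType) (lam : 'I_4 -> R) (r : nat) (i : 'I_2)
    (b : 'I_4) : jet_function R :=
  fun p => match r with
    | 0 => bracket (Q 0) (Xcoef0 lam i) b p
    | r'.+1 => bracket (Q r'.+1) (Xcoef0 lam i) b p
               - bracket (Q r') (Xcoef1 lam i) b p
    end.

Definition regular {R : realType} : set (jet_space R) :=
  [set p | Dx x2 u p * Dx x1 v p != 0].

(* The points of the jet space at which (S), the equations defining the
   nonlocal variables and all their differential consequences hold. A relation
   between jet functions holds modulo these equations when it holds at every
   point of this set. *)
Definition covering (R : realType) (lam : 'I_4 -> R) : set (jet_space R) :=
  [set p | [/\ regular p,
    (forall s : seq 'I_4, Dxs s (S1 lam u v) p = 0),
    (forall s : seq 'I_4, Dxs s (S2 lam u v) p = 0) &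
    (forall (s : seq 'I_4) (r : nat) (i : 'I_2) (b : 'I_4),
       Dxs s (nonlocal_eq lam r i b) p = 0)]].

Definition partials (R : realType) (n : nat) (s : seq 'I_n)
    (g : 'rV[R]_n -> R) : 'rV[R]_n -> R :=
  foldr (fun i h => (fun x => 'D_(delta_mx 0 i : 'rV[R]_n) h x)) g s.

Definition smooth_on (R : realType) (n : nat) (O : set 'rV[R]_n)
    (g : 'rV[R]_n -> R) : Prop :=
  open O /\
  forall (s : seq 'I_n) (x : 'rV[R]_n), O x ->
    {for x, continuous (partials s g)} /\
    (forall i : 'I_n, derivable (partials s g) x (delta_mx 0 i : 'rV[R]_n)).

(* Smooth functions of finitely many jet coordinates, on the regular jets. *)
Definition smooth_jet_function (R : realType) (f : jet_function R) : Prop :=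
  exists (n : nat) (c : 'I_n -> coordinate) (O : set 'rV[R]_n)
         (g : 'rV[R]_n -> R),
    smooth_on O g /\
    forall p : jet_space R, regular p ->
      O (\row_k p (c k)) /\ f p = g (\row_k p (c k)).

(* [is_derive] rather than a bare derivative: the latter takes a default
   value where the derivative does not exist. *)
Definition nonlocal_symmetry (R : realType) (lam : 'I_4 -> R)
    (U V : jet_function R) : Prop :=
  [/\ smooth_jet_function U, smooth_jet_function V &
    forall p : jet_space R, covering lam p ->
      is_derive (0 : R) 1
        (fun eps : R => S1 lam (fun q => u q + eps * U q)
                               (fun q => v q + eps * V q) p) 0
      /\
      is_derive (0 : R) 1
        (fun eps : R => S2 lam (fun q => u q + eps * U q)
                               (fun q => v q + eps * V q) p) 0].

(* Main.v *)
Require Import Defs.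
From mathcomp Require Import all_boot all_order all_algebra.
From mathcomp Require Import all_classical all_reals all_analysis.
From mathcomp Require Import ring.
Set Implicit Arguments.
Unset Strict Implicit.
Unset Printing Implicit Defensive.
Import Order.TTheory GRing.Theory Num.Theory.
Import numFieldNormedType.Exports.
Local Open Scope classical_set_scope.
Local Open Scope ring_scope.

(** The jet coordinates being fixed, write X'_m for X_i^(1) and X_m for X_i^(0),
    with m = 4 for i = 0 and m = 3 for i = 1, and for a pair Y_3, Y_4 of vector
    fields put
      Z(Y) = [X'_4, Y_3] - [X'_3, Y_4],
    which is additive in Y.

    Let N_m be the vector field whose components are the equations defining
    the nonlocal variables at level r, so that N_m = [Q_r, X_m] for r = 0 and
    N_m = [Q_r, X_m] - [Q_(r-1), X'_m] for r > 0. On the covering the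
    components of N_3 and N_4 and their total derivatives vanish, hence Z(N)
    vanishes ([double_bracket_nonlocal]).

    On the other hand Z can be computed modulo (S) and its first derivatives.
    For Y_m = [Q_(r-1), X'_m] it is zero: by the Jacobi identity it is
    [Q_(r-1), [X'_4, X'_3]], and (S) makes X'_3 and X'_4 commute. For
    Y_m = [Q_r, X_m] its components along x^1 and x^2, multiplied by
      (lam_1 - lam_2) u_2 v_1^2   and   - (lam_1 - lam_2) v_1 u_2^2,
    are the left-hand sides of the second and of the first equation of (S)
    linearized in the direction (xi_r^2 u_2, - xi_r^1 v_1). Both facts are
    instances of one identity for each component ([double_bracket_x1] and
    [double_bracket_x2]). As Z(N) = 0, the linearized equations hold. The
    equations N_m = 0 are not solved for the x^3- and x^4-derivatives of the
    nonlocal variables, so lam_3 and lam_4 are allowed to vanish.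

    Total derivatives being limits along lines in the jet space, all functions
    at hand are represented by formal rational expressions in the jet
    coordinates, on which total derivation is computed formally ([rep_Dx]);
    each of the identities above is then one between rational fractions. *)

(** * Rational expressions in the jet coordinates *)

(** Formal rational expressions in the jet coordinates of the unknowns. *)
Inductive jexpr (R : realType) :=
  | jcst of R
  | jvar of unknown & multi_index
  | jadd of jexpr R & jexpr R
  | jopp of jexpr R
  | jmul of jexpr R & jexpr R
  | jinv of jexpr R.
Arguments jvar {R}.

Declare Scope jexpr_scope.
Delimit Scope jexpr_scope with J.
Bind Scope jexpr_scope with jexpr.
Local Notation "e1 + e2" := (jadd e1 e2) : jexpr_scope.
Local Notation "- e" := (jopp e) : jexpr_scope.
Local Notation "e1 - e2" := (jadd e1 (jopp e2)) : jexpr_scope.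
Local Notation "e1 * e2" := (jmul e1 e2) : jexpr_scope.
Local Notation "e1 / e2" := (jmul e1 (jinv e2)) : jexpr_scope.

Fixpoint jeval {R : realType} (e : jexpr R) (p : jet_space R) : R :=
  match e with
  | jcst c => c
  | jvar w al => p (Jet w al)
  | jadd e1 e2 => jeval e1 p + jeval e2 p
  | jopp e1 => - jeval e1 p
  | jmul e1 e2 => jeval e1 p * jeval e2 p
  | jinv e1 => (jeval e1 p)^-1
  end.

(** No denominator of the expression vanishes at the given jet. *)
Fixpoint jdefined {R : realType} (e : jexpr R) (p : jet_space R) : Prop :=
  match e with
  | jcst _ | jvar _ _ => True
  | jadd e1 e2 | jmul e1 e2 => jdefined e1 p /\ jdefined e2 p
  | jopp e1 => jdefined e1 p
  | jinv e1 => jdefined e1 p /\ jeval e1 p != 0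
  end.

(** The total derivative D_i, computed formally. *)
Fixpoint jD {R : realType} (i : 'I_4) (e : jexpr R) : jexpr R :=
  match e with
  | jcst _ => jcst 0
  | jvar w al => jvar w (incr i al)
  | jadd e1 e2 => jD i e1 + jD i e2
  | jopp e1 => - jD i e1
  | jmul e1 e2 => jD i e1 * e2 + e1 * jD i e2
  | jinv e1 => - (jD i e1 * (jinv e1 * jinv e1))
  end%J.

(** The line through [p] directed by the value at [p] of the total vector
    field D_i. *)
Definition line {R : realType} (i : 'I_4) (p : jet_space R) (t : R) :
  jet_space R := fun c => p c + t * total_vector i p c.

Lemma line0 {R : realType} (i : 'I_4) (p : jet_space R) : line i p 0 = p.
Proof. by apply/funext => c; rewrite /line mul0r addr0. Qed.

Lemma is_derive_line (R : realType) (i : 'I_4) (e : jexpr R)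
    (p : jet_space R) :
  jdefined e p ->
  is_derive (0 : R) 1 (fun t => jeval e (line i p t)) (jeval (jD i e) p).
Proof.
elim: e => [c|w al|e1 IH1 e2 IH2|e1 IH1|e1 IH1 e2 IH2|e1 IH1] /=.
- by move=> _; exact: is_derive_cst.
- move=> _; rewrite /line /=; set a := p _; set b := p _.
  have -> : (fun t : R => a + t * b) = cst a + (id \* cst b) by exact/funext.
  apply: (is_derive_eq (is_deriveD _ _)).
  by rewrite scaler0 add0r add0r -[LHS]/(b * 1) mulr1.
- by move=> [/IH1 h1 /IH2 h2]; exact: is_deriveD.
- by move=> /IH1 h1; exact: is_deriveN.
- move=> [/IH1 h1 /IH2 h2].
  apply: (is_derive_eq (is_deriveM h1 h2)).
  by rewrite line0 addrC -[LHS]/(_ * _ + _ * _) [X in X + _]mulrC.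
- move=> [/IH1 [h1 h1E] ne].
  have ne' : jeval e1 (line i p 0) != 0 by rewrite line0.
  split; first exact: derivableV.
  by rewrite deriveV // h1E line0 -[LHS]/(_ * _) mulNr -exprVn mulrC expr2.
Qed.

Lemma jdefined_jD (R : realType) (i : 'I_4) (e : jexpr R) (p : jet_space R) :
  jdefined e p -> jdefined (jD i e) p.
Proof.
elim: e => //= [e1 IH1 e2 IH2 [/IH1 ? /IH2]|e1 IH1 e2 IH2 [? ?]|e1 IH1 [? ?]];
  by do ?split => //; (apply: IH1 || apply: IH2).
Qed.

Lemma Dx_jetE (R : realType) (i : 'I_4) (w : unknown) (al : multi_index) :
  Dx i (fun q : jet_space R => q (Jet w al)) = fun q => q (Jet w (incr i al)).
Proof. by apply/funext => p; exact: Dx_jet. Qed.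

Definition u_expr {R : realType} : jexpr R := jvar unk_u [ffun=> 0%N].
Definition v_expr {R : realType} : jexpr R := jvar unk_v [ffun=> 0%N].
Definition xi1_expr {R : realType} (r : nat) : jexpr R :=
  jvar (unk_xi1 r) [ffun=> 0%N].
Definition xi2_expr {R : realType} (r : nat) : jexpr R :=
  jvar (unk_xi2 r) [ffun=> 0%N].

Lemma regularE {R : realType} (p : jet_space R) :
  regular p = (jeval (jD x2 u_expr * jD x1 v_expr) p != 0) :> Prop.
Proof. by rewrite /regular /= /u /v /unknown_fun !Dx_jetE. Qed.

Lemma near_regular {R : realType} (i : 'I_4) (p : jet_space R) :
  regular p -> \forall t \near (0 : R), regular (line i p t).
Proof.
rewrite regularE; set e := (_ * _)%J => ne.
have [d _] : is_derive (0 : R) 1 (fun t => jeval e (line i p t))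
    (jeval (jD i e) p) by exact: is_derive_line.
have /differentiable_continuous c :
  differentiable (fun t => jeval e (line i p t)) (0 : R).
  exact/derivable1_diffP.
have : \forall x \near (jeval e (line i p 0)), x != 0.
  rewrite line0.
  have : open_nbhs (jeval e p) [set x : R | x != 0].
    by split => //; exact: open_neq.
  by move=> /open_nbhs_nbhs.
by move=> /c h; near=> t; rewrite regularE; near: t; exact: h.
Unshelve. all: by end_near. Qed.

(** The jet function [f] is given on the regular jets by the expression [e],
    which has no vanishing denominator there. *)
Definition rep {R : realType} (e : jexpr R) (f : jet_function R) : Prop :=
  forall p, regular p -> jdefined e p /\ f p = jeval e p.

Lemma rep_cst {R : realType} (c : R) : rep (jcst c) (fun=> c).
Proof. by []. Qed.

Lemma rep_add {R : realType} (e1 e2 : jexpr R) (f1 f2 : jet_function R) :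
  rep e1 f1 -> rep e2 f2 -> rep (e1 + e2) (fun p => f1 p + f2 p).
Proof.
by move=> h1 h2 p rp; have [? /= ->] := h1 p rp; have [? ->] := h2 p rp.
Qed.

Lemma rep_opp {R : realType} (e : jexpr R) (f : jet_function R) :
  rep e f -> rep (- e) (fun p => - f p).
Proof. by move=> h p rp; have [? /= ->] := h p rp. Qed.

Lemma rep_mul {R : realType} (e1 e2 : jexpr R) (f1 f2 : jet_function R) :
  rep e1 f1 -> rep e2 f2 -> rep (e1 * e2) (fun p => f1 p * f2 p).
Proof.
by move=> h1 h2 p rp; have [? /= ->] := h1 p rp; have [? ->] := h2 p rp.
Qed.

Lemma rep_ext {R : realType} (e : jexpr R) (f g : jet_function R) :
  f = g -> rep e f -> rep e g.
Proof. by move=> ->. Qed.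

(** Only the values at regular jets matter: regularity is an open condition
    along every line. *)
Lemma rep_Dx {R : realType} (i : 'I_4) (e : jexpr R) (f : jet_function R) :
  rep e f -> rep (jD i e) (Dx i f).
Proof.
move=> ef p rp; have [de fe] := ef p rp.
split; first exact: jdefined_jD.
rewrite /Dx derive1E -[LHS]/('D_1 (fun t => f (line i p t)) 0).
have [_ <-] := is_derive_line i de.
apply: near_eq_derive.
have := near_regular i rp; apply: filterS => t rt.
by have [_ ->] := ef _ rt.
Qed.

(** * Vector fields *)

Definition jvfield (R : realType) := 'I_4 -> jexpr R.

(** The vector field [pencil lam m l] with each factor [l - lam k] replaced by
    [- mu k]: [mu = lam] gives X_i^(0), and [mu = 1] gives X_i^(1). *)
Definition X_expr {R : realType} (lam mu : 'I_4 -> R) (m : 'I_4) : jvfield R :=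
  fun a => match nat_of_ord a with
  | 0%N => (jcst (- mu x1 * ((lam x2 - lam m) / (lam x1 - lam x2)))
             * (jD m v_expr / jD x1 v_expr))%J
  | 1%N => (jcst (mu x2 * ((lam x1 - lam m) / (lam x1 - lam x2)))
             * (jD m u_expr / jD x2 u_expr))%J
  | _ => jcst (if a == m then - mu m else 0)
  end.

Definition Q_expr {R : realType} (r : nat) : jvfield R :=
  fun a => match nat_of_ord a with
  | 0%N => xi1_expr r
  | 1%N => xi2_expr r
  | _ => jcst 0
  end.

(** The derivative of [f] along the vector field [X]. *)
Definition japply {R : realType} (X : jvfield R) (f : jexpr R) : jexpr R :=
  (X x1 * jD x1 f + X x2 * jD x2 f + X x3 * jD x3 f + X x4 * jD x4 f)%J.

Definition jbracket {R : realType} (X Y : jvfield R) : jvfield R :=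
  fun b => (japply X (Y b) - japply Y (X b))%J.

Lemma big_x4 (R : realType) (F : 'I_4 -> R) :
  \sum_(a < 4) F a = F x1 + F x2 + F x3 + F x4.
Proof.
rewrite !big_ord_recl big_ord0 addr0 !addrA.
by congr (F _ + F _ + F _ + F _); apply/val_inj.
Qed.

Lemma ord4P (P : 'I_4 -> Prop) : P x1 -> P x2 -> P x3 -> P x4 -> forall a, P a.
Proof.
move=> h1 h2 h3 h4 [[|[|[|[|//]]]] i].
- by rewrite (_ : Ordinal i = x1) //; exact/val_inj.
- by rewrite (_ : Ordinal i = x2) //; exact/val_inj.
- by rewrite (_ : Ordinal i = x3) //; exact/val_inj.
- by rewrite (_ : Ordinal i = x4) //; exact/val_inj.
Qed.

Lemma rep_bracket {R : realType} (E F : jvfield R) (X Y : vector_field R) :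
  (forall a, rep (E a) (X a)) -> (forall a, rep (F a) (Y a)) ->
  forall b, rep (jbracket E F b) (bracket X Y b).
Proof.
move=> EX FY b.
have rep_apply (E' F' : jvfield R) (X' Y' : vector_field R) :
    (forall a, rep (E' a) (X' a)) -> (forall a, rep (F' a) (Y' a)) ->
    rep (japply E' (F' b)) (fun p => \sum_(a < 4) X' a p * Dx a (Y' b) p).
  move=> EX' FY'; rewrite (_ : (fun p => _) = (fun p =>
      X' x1 p * Dx x1 (Y' b) p + X' x2 p * Dx x2 (Y' b) p
      + X' x3 p * Dx x3 (Y' b) p + X' x4 p * Dx x4 (Y' b) p)); last first.
    by apply/funext => p; rewrite big_x4.
  by do 3?[apply: rep_add]; apply: rep_mul => //; apply: rep_Dx.
apply: rep_ext (rep_add (rep_apply _ _ _ _ EX FY)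
                        (rep_opp (rep_apply _ _ _ _ FY EX))).
by apply/funext => p; rewrite /bracket sumrB.
Qed.

Lemma rep_quotient {R : realType} (f g : jexpr R) (F G : jet_function R)
    (c : R) : rep f F -> rep g G -> (forall p, regular p -> G p != 0) ->
  rep (jcst c * (f / g)) (fun p => c * (F p / G p)).
Proof.
move=> hf hg ne p rp; have [? /= ->] := hf p rp; have [? gE] := hg p rp.
by move: (ne p rp); rewrite gE.
Qed.

Lemma rep_u {R : realType} : rep u_expr (@u R). Proof. by []. Qed.
Lemma rep_v {R : realType} : rep v_expr (@v R). Proof. by []. Qed.

Lemma rep_pencil {R : realType} (lam mu : 'I_4 -> R) (m : 'I_4)
    (X : vector_field R) : m = x3 \/ m = x4 ->
  X = (fun a p => if a == x1 then
        - mu x1 * ((lam x2 - lam m) / (lam x1 - lam x2)) *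
          (Dx m v p / Dx x1 v p)
      else if a == x2 then
        mu x2 * ((lam x1 - lam m) / (lam x1 - lam x2)) *
          (Dx m u p / Dx x2 u p)
      else if a == m then - mu m else 0) ->
  forall a, rep (X_expr lam mu m a) (X a).
Proof.
move=> mE -> ; apply: ord4P.
- apply: rep_quotient; [exact: rep_Dx rep_v|exact: rep_Dx rep_v|].
  by move=> p; rewrite /regular /= mulf_eq0 negb_or => /andP[].
- apply: rep_quotient; [exact: rep_Dx rep_u|exact: rep_Dx rep_u|].
  by move=> p; rewrite /regular /= mulf_eq0 negb_or => /andP[].
- exact: rep_cst.
- exact: rep_cst.
Qed.

(** x^4 for i = 0 and x^3 for i = 1. *)
Definition X_index (i : 'I_2) : 'I_4 := if i == 0 :> nat then x4 else x3.

Lemma X_indexP i : X_index i = x3 \/ X_index i = x4.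
Proof. by rewrite /X_index; case: ifP; [right|left]. Qed.

Lemma rep_Xcoef0 {R : realType} (lam : 'I_4 -> R) i a :
  rep (X_expr lam lam (X_index i) a) (Xcoef0 lam i a).
Proof.
apply: rep_pencil; first exact: X_indexP.
apply/funext => b; apply/funext => p; rewrite /Xcoef0 /X -/(X_index i) /pencil.
by do ?[case: ifP => _]; ring.
Qed.

Lemma rep_Xcoef1 {R : realType} (lam : 'I_4 -> R) i a :
  rep (X_expr lam (fun=> 1) (X_index i) a) (Xcoef1 lam i a).
Proof.
apply: rep_pencil; first exact: X_indexP.
apply/funext => b; apply/funext => p.
rewrite /Xcoef1 /X -/(X_index i) /pencil.
by do ?[case: ifP => _]; ring.
Qed.

Lemma rep_Q {R : realType} r a : rep (Q_expr r a) (@Q R r a).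
Proof. by move: a; apply: ord4P. Qed.

(** The vector field whose components are the equations at level [r]. *)
Definition nonlocal_expr {R : realType} (lam : 'I_4 -> R) (r : nat) (m : 'I_4) :
    jvfield R :=
  match r with
  | 0 => jbracket (Q_expr 0) (X_expr lam lam m)
  | r'.+1 => fun b => (jbracket (Q_expr r'.+1) (X_expr lam lam m) b
               - jbracket (Q_expr r') (X_expr lam (fun=> 1%R) m) b)%J
  end.

Lemma rep_nonlocal {R : realType} (lam : 'I_4 -> R) r i b :
  rep (nonlocal_expr lam r (X_index i) b) (nonlocal_eq lam r i b).
Proof.
case: r => [|r] /=.
  by apply: rep_bracket => a; [exact: rep_Q|exact: rep_Xcoef0].
apply: rep_add; last apply: rep_opp.
  by apply: rep_bracket => a; [exact: rep_Q|exact: rep_Xcoef0].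
by apply: rep_bracket => a; [exact: rep_Q|exact: rep_Xcoef1].
Qed.

(** * The system and its linearization *)

Definition S_expr {R : realType} (lam : 'I_4 -> R) (f g w : jexpr R) :
    jexpr R :=
  (jcst ((lam x3 - lam x4) * (lam x1 - lam x2)) *
      (jD x1 g * jD x2 f * jD x3 (jD x4 w))
  + jcst ((lam x2 - lam x3) * (lam x1 - lam x4)) *
      (jD x1 g * jD x4 f * jD x2 (jD x3 w)
       - jD x3 g * jD x4 f * jD x1 (jD x2 w)
       + jD x3 g * jD x2 f * jD x1 (jD x4 w))
  - jcst ((lam x2 - lam x4) * (lam x1 - lam x3)) *
      (jD x1 g * jD x3 f * jD x2 (jD x4 w)
       - jD x4 g * jD x3 f * jD x1 (jD x2 w)
       + jD x4 g * jD x2 f * jD x1 (jD x3 w)))%J.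

Lemma rep_S {R : realType} (lam : 'I_4 -> R) (f g w : jexpr R)
    (F G W : jet_function R) :
  rep f F -> rep g G -> rep w W -> rep (S_expr lam f g w) (S_op lam F G W).
Proof.
move=> hf hg hw; rewrite /S_expr /S_op.
by do ?[exact: rep_cst | apply: rep_add | apply: rep_mul | apply: rep_opp
       | apply: rep_Dx | assumption].
Qed.

(** The derivative of [S_expr lam f g w] in the direction ([F], [G], [W]), by
    trilinearity. *)
Definition lin_expr {R : realType} (lam : 'I_4 -> R) (f g w F G W : jexpr R) :
    jexpr R :=
  (S_expr lam F g w + S_expr lam f G w + S_expr lam f g W)%J.

Lemma is_derive_cubic {R : realType} (c0 c1 c2 c3 : R) :
  is_derive (0 : R) 1
    (fun eps => c0 + eps * (c1 + eps * (c2 + eps * c3))) c1.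
Proof.
have hI : is_derive (0 : R) 1 id (1 : R) := is_derive_id _ _.
have hK (c : R) : is_derive (0 : R) 1 (cst c) (0 : R) := is_derive_cst _ _ _.
have [d dE] := is_deriveD (hK c0) (is_deriveM hI (is_deriveD (hK c1)
  (is_deriveM hI (is_deriveD (hK c2) (is_deriveM hI (hK c3)))))).
split; first exact: d.
rewrite [LHS]dE scale0r !add0r.
transitivity ((c1 + 0 * (c2 + 0 * c3)) * 1); first by [].
by rewrite mul0r addr0 mulr1.
Qed.

Lemma is_derive_S {R : realType} (lam : 'I_4 -> R) (f g w F G W : jexpr R)
    (f' g' w' F' G' W' : jet_function R) (p : jet_space R) :
  rep f f' -> rep g g' -> rep w w' -> rep F F' -> rep G G' -> rep W W' ->
  regular p ->
  is_derive (0 : R) 1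
    (fun eps => S_op lam (fun q => f' q + eps * F' q)
       (fun q => g' q + eps * G' q) (fun q => w' q + eps * W' q) p)
    (jeval (lin_expr lam f g w F G W) p).
Proof.
move=> hf hg hw hF hG hW rp.
(* By trilinearity the function of [eps] is a cubic polynomial. *)
have -> : (fun eps => S_op lam (fun q => f' q + eps * F' q)
       (fun q => g' q + eps * G' q) (fun q => w' q + eps * W' q) p) =
  (fun eps => jeval (S_expr lam f g w) p +
     eps * (jeval (lin_expr lam f g w F G W) p +
     eps * (jeval (S_expr lam F G w + S_expr lam F g W + S_expr lam f G W) p +
     eps * jeval (S_expr lam F G W) p))).
  apply/funext => eps.
  have hD (e E : jexpr R) (e' E' : jet_function R) : rep e e' -> rep E E' ->
      rep (e + jcst eps * E)%J (fun q => e' q + eps * E' q).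
    move=> he hE; apply: rep_add => //.
    by apply: rep_mul => //; exact: rep_cst.
  have [_ ->] := rep_S lam (hD _ _ _ _ hf hF) (hD _ _ _ _ hg hG)
    (hD _ _ _ _ hw hW) rp.
  by rewrite /lin_expr /S_expr /=; ring.
exact: is_derive_cubic.
Qed.

(** * The commutator identity *)

Lemma incrC i j al : incr i (incr j al) = incr j (incr i al).
Proof. by apply/ffunP => k; rewrite !ffunE addnAC. Qed.

(* Rewrites iterated derivatives to a sorted order, so that equal jet
   coordinates become syntactically equal. *)
Definition incr_sorted :=
  (incrC x2 x1, incrC x3 x1, incrC x4 x1, incrC x3 x2, incrC x4 x2,
   incrC x4 x3).

(** The characteristic ([U_expr r], [V_expr r]). *)
Definition U_expr {R : realType} (r : nat) : jexpr R :=
  (xi2_expr r * jD x2 u_expr)%J.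
Definition V_expr {R : realType} (r : nat) : jexpr R :=
  (- (xi1_expr r * jD x1 v_expr))%J.

(** [X'_4, Y_3] - [X'_3, Y_4], where X'_m is the part X_i^(1) of the pencil. *)
Definition double_bracket {R : realType} (lam : 'I_4 -> R)
    (Y : 'I_4 -> jvfield R) : jvfield R :=
  fun b => (jbracket (X_expr lam (fun=> 1%R) x4) (Y x3) b
            - jbracket (X_expr lam (fun=> 1%R) x3) (Y x4) b)%J.

(* Proves an identity of rational expressions at the jet [p], where u_2, v_1
   and [lam x1 - lam x2] are nonzero, after turning the jet coordinates and the
   [lam k] into independent variables. *)
Ltac jet_field p lam :=
  rewrite /lin_expr /S_expr /U_expr /V_expr /double_bracket /jbracket /japply
    /X_expr /Q_expr /= !incr_sorted;
  move: (lam x1) (lam x2) (lam x3) (lam x4) => ? ? ? ?;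
  repeat match goal with
  | |- context [p (Jet ?w ?al)] => move: (p (Jet w al)) => ?
  end;
  by move=> *; field; apply/and3P.

Lemma regularP {R : realType} (p : jet_space R) : regular p ->
  jeval (jD x2 u_expr) p != 0 /\ jeval (jD x1 v_expr) p != 0.
Proof. by rewrite regularE /= mulf_eq0 negb_or => /andP[]. Qed.

(** With [mu] affine in [lam], the x^2-component of the double bracket of the
    fields [Q_r, X_m^mu] is a multiple of the first linearized equation. The
    values (0, 1) and (1, 0) of ([s], [t]) give X_i^(0) and X_i^(1). *)
Lemma double_bracket_x2 {R : realType} (lam : 'I_4 -> R) (s t : R) (r : nat)
    (p : jet_space R) :
  let mu k := s + t * lam k in
  lam x1 - lam x2 != 0 -> regular p ->
  jeval (S_expr lam u_expr v_expr u_expr) p = 0 ->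
  jeval (S_expr lam u_expr v_expr v_expr) p = 0 ->
  (forall k, jeval (jD k (S_expr lam u_expr v_expr u_expr)) p = 0) ->
  (lam x1 - lam x2) * jeval (jD x1 v_expr * (jD x2 u_expr * jD x2 u_expr)) p *
    jeval (double_bracket lam
             (fun m => jbracket (Q_expr r) (X_expr lam mu m)) x2) p =
  - t * jeval (lin_expr lam u_expr v_expr u_expr
                 (U_expr r) (V_expr r) (U_expr r)) p.
Proof.
move=> mu l12 rp S1_eq0 S2_eq0 DS1_eq0.
pose at_p e := jeval e p.
pose u2 := at_p (jD x2 u_expr); pose v1 := at_p (jD x1 v_expr).
pose xi1 := at_p (xi1_expr r); pose xi2 := at_p (xi2_expr r).
(* The multipliers of D_1 S1, D_2 S1, S1 and S2 are found by comparing the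
   coefficients of u_134, u_234, u_34 and v_34 on both sides. *)
transitivity
 (- t * jeval (lin_expr lam u_expr v_expr u_expr
                 (U_expr r) (V_expr r) (U_expr r)) p
  + (mu x2 * xi1 * at_p (jD x1 (S_expr lam u_expr v_expr u_expr))
    + mu x1 * xi2 * at_p (jD x2 (S_expr lam u_expr v_expr u_expr))
    + (- mu x2 * (at_p (jD x2 (xi2_expr r))
                  + (xi1 * at_p (jD x1 (jD x2 u_expr))
                     + xi2 * at_p (jD x2 (jD x2 u_expr))) / u2)
       + (mu x1 - mu x2) * (at_p (jD x2 (U_expr r)) / u2
                            + at_p (jD x1 (V_expr r)) / v1)
       - mu x2 * xi1 * (at_p (jD x1 (jD x1 v_expr)) / v1
                        + at_p (jD x1 (jD x2 u_expr)) / u2)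
       - mu x1 * xi2 * (at_p (jD x1 (jD x2 v_expr)) / v1
                        + at_p (jD x2 (jD x2 u_expr)) / u2))
      * at_p (S_expr lam u_expr v_expr u_expr)
    + mu x1 * at_p (jD x1 (xi2_expr r)) * u2 / v1
      * at_p (S_expr lam u_expr v_expr v_expr))
  / (lam x1 - lam x2)); last first.
  by rewrite /at_p S1_eq0 S2_eq0 !DS1_eq0 !(mulr0, addr0) mul0r addr0.
have [] := regularP rp; move: l12; clear rp S1_eq0 S2_eq0 DS1_eq0.
rewrite /u2 /v1 /xi1 /xi2 /at_p /mu {at_p u2 v1 xi1 xi2}.
jet_field p lam.
Qed.

(** The image of [double_bracket_x2] under the symmetry of (S) exchanging x^1
    with x^2, lam_1 with lam_2, u with v and xi^1 with xi^2. *)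
Lemma double_bracket_x1 {R : realType} (lam : 'I_4 -> R) (s t : R) (r : nat)
    (p : jet_space R) :
  let mu k := s + t * lam k in
  lam x1 - lam x2 != 0 -> regular p ->
  jeval (S_expr lam u_expr v_expr u_expr) p = 0 ->
  jeval (S_expr lam u_expr v_expr v_expr) p = 0 ->
  (forall k, jeval (jD k (S_expr lam u_expr v_expr v_expr)) p = 0) ->
  (lam x1 - lam x2) * jeval (jD x2 u_expr * (jD x1 v_expr * jD x1 v_expr)) p *
    jeval (double_bracket lam
             (fun m => jbracket (Q_expr r) (X_expr lam mu m)) x1) p =
  t * jeval (lin_expr lam u_expr v_expr v_expr
               (U_expr r) (V_expr r) (V_expr r)) p.
Proof.
move=> mu l12 rp S1_eq0 S2_eq0 DS2_eq0.
pose at_p e := jeval e p.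
pose u2 := at_p (jD x2 u_expr); pose v1 := at_p (jD x1 v_expr).
pose xi1 := at_p (xi1_expr r); pose xi2 := at_p (xi2_expr r).
transitivity
 (t * jeval (lin_expr lam u_expr v_expr v_expr
               (U_expr r) (V_expr r) (V_expr r)) p
  - (mu x1 * xi2 * at_p (jD x2 (S_expr lam u_expr v_expr v_expr))
    + mu x2 * xi1 * at_p (jD x1 (S_expr lam u_expr v_expr v_expr))
    + (- mu x1 * (at_p (jD x1 (xi1_expr r))
                  + (xi2 * at_p (jD x1 (jD x2 v_expr))
                     + xi1 * at_p (jD x1 (jD x1 v_expr))) / v1)
       + (mu x1 - mu x2) * (at_p (jD x1 (V_expr r)) / v1
                            + at_p (jD x2 (U_expr r)) / u2)
       - mu x1 * xi2 * (at_p (jD x2 (jD x2 u_expr)) / u2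
                        + at_p (jD x1 (jD x2 v_expr)) / v1)
       - mu x2 * xi1 * (at_p (jD x1 (jD x2 u_expr)) / u2
                        + at_p (jD x1 (jD x1 v_expr)) / v1))
      * at_p (S_expr lam u_expr v_expr v_expr)
    + mu x2 * at_p (jD x2 (xi1_expr r)) * v1 / u2
      * at_p (S_expr lam u_expr v_expr u_expr))
  / (lam x1 - lam x2)); last first.
  by rewrite /at_p S1_eq0 S2_eq0 !DS2_eq0 !(mulr0, addr0) mul0r subr0.
have [] := regularP rp; move: l12; clear rp S1_eq0 S2_eq0 DS2_eq0.
rewrite /u2 /v1 /xi1 /xi2 /at_p /mu {at_p u2 v1 xi1 xi2}.
jet_field p lam.
Qed.

(** * The linearized equations on the covering *)

Lemma vanishing_expr {R : realType} (p : jet_space R) e f :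
  regular p -> rep e f -> (forall s, Dxs s f p = 0) ->
  jeval e p = 0 /\ forall k, jeval (jD k e) p = 0.
Proof.
move=> rp ef f0; split => [|k].
  by have [_ <-] := ef p rp; exact: (f0 [::]).
by have [_ <-] := rep_Dx k ef rp; exact: (f0 [:: k]).
Qed.

Lemma double_bracketB {R : realType} (lam : 'I_4 -> R)
    (Y Y' : 'I_4 -> jvfield R) b p :
  jeval (double_bracket lam (fun m a => Y m a - Y' m a)%J b) p =
  jeval (double_bracket lam Y b) p - jeval (double_bracket lam Y' b) p.
Proof. by rewrite /double_bracket /jbracket /japply /=; ring. Qed.

Lemma double_bracket_nonlocal {R : realType} (lam : 'I_4 -> R) r b
    (p : jet_space R) :
  covering lam p ->
  jeval (double_bracket lam (nonlocal_expr lam r) b) p = 0.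
Proof.
move=> cp; have [rp _ _ nl] := cp.
have nl0 m a : m = x3 \/ m = x4 -> jeval (nonlocal_expr lam r m a) p = 0 /\
    forall k, jeval (jD k (nonlocal_expr lam r m a)) p = 0.
  case=> ->.
  - have rN := @rep_nonlocal R lam r (@Ordinal 2 1 isT) a.
    by apply: (vanishing_expr rp rN) => s; exact: nl.
  - have rN := @rep_nonlocal R lam r (@Ordinal 2 0 isT) a.
    by apply: (vanishing_expr rp rN) => s; exact: nl.
have nlV m a (hm : m = x3 \/ m = x4) := (nl0 m a hm).1.
have nlD m a k (hm : m = x3 \/ m = x4) := (nl0 m a hm).2 k.
have h3 : x3 = x3 \/ x3 = x4 by left.
have h4 : x4 = x3 \/ x4 = x4 by right.
rewrite /double_bracket /jbracket /japply.
move: (nonlocal_expr _ _) nlV nlD {nl0 nl} => N nlV nlD /=.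
by rewrite !(nlV x3) // !(nlV x4) // !(nlD x3) // !(nlD x4) //; ring.
Qed.

(** The linearization of (S) at ([U_expr r], [V_expr r]) vanishes. *)
Lemma linearization_eq0 {R : realType} (lam : 'I_4 -> R) r (p : jet_space R) :
  injective lam -> covering lam p ->
  jeval (lin_expr lam u_expr v_expr u_expr
           (U_expr r) (V_expr r) (U_expr r)) p = 0 /\
  jeval (lin_expr lam u_expr v_expr v_expr
           (U_expr r) (V_expr r) (V_expr r)) p = 0.
Proof.
move=> inj cp; have [rp hS1 hS2 _] := cp.
have l12 : lam x1 - lam x2 != 0 by rewrite subr_eq0; apply/eqP => /inj.
have [u2_neq0 v1_neq0] := regularP rp.
have [S1_eq0 DS1_eq0] := vanishing_expr rp (rep_S lam rep_u rep_v rep_u) hS1.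
have [S2_eq0 DS2_eq0] := vanishing_expr rp (rep_S lam rep_u rep_v rep_v) hS2.
have X0E : X_expr lam lam = X_expr lam (fun k => 0 + 1 * lam k).
  by congr X_expr; apply/funext => k; rewrite add0r mul1r.
have X1E : X_expr lam (fun=> 1) = X_expr lam (fun k => 1 + 0 * lam k).
  by congr X_expr; apply/funext => k; rewrite mul0r addr0.
pose Z0 := double_bracket lam
  (fun m => jbracket (Q_expr r) (X_expr lam lam m)).
have Z0_eq0 b : b = x1 \/ b = x2 -> jeval (Z0 b) p = 0.
  move=> hb; have := double_bracket_nonlocal r b cp.
  case: r @Z0 => [//|r'] Z0.
  rewrite -[double_bracket _ _ _]/(double_bracket lam (fun m a =>
    jbracket (Q_expr r'.+1) (X_expr lam lam m) a
    - jbracket (Q_expr r') (X_expr lam (fun=> 1%R) m) a)%J b) double_bracketB.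
  (* The contribution of [Q_r'] vanishes: case (s, t) = (1, 0). *)
  suff -> : jeval (double_bracket lam (fun m =>
      jbracket (Q_expr r') (X_expr lam (fun=> 1) m)) b) p = 0 by rewrite subr0.
  apply/eqP; rewrite X1E; case: hb => ->.
  - have := double_bracket_x1 1 0 r' l12 rp S1_eq0 S2_eq0 DS2_eq0.
    move/eqP; rewrite mul0r mulf_eq0 => /orP[|//].
    by rewrite /= !mulf_eq0 (negPf l12) (negPf u2_neq0) (negPf v1_neq0).
  - have := double_bracket_x2 1 0 r' l12 rp S1_eq0 S2_eq0 DS1_eq0.
    move/eqP; rewrite oppr0 mul0r mulf_eq0 => /orP[|//].
    by rewrite /= !mulf_eq0 (negPf l12) (negPf u2_neq0) (negPf v1_neq0).
split.
- have := double_bracket_x2 0 1 r l12 rp S1_eq0 S2_eq0 DS1_eq0.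
  rewrite -X0E (Z0_eq0 x2 (or_intror erefl)) mulr0 mulN1r => /esym/eqP.
  by rewrite oppr_eq0 => /eqP.
- have := double_bracket_x1 0 1 r l12 rp S1_eq0 S2_eq0 DS2_eq0.
  by rewrite -X0E (Z0_eq0 x1 (or_introl erefl)) mulr0 mul1r => /esym.
Qed.

(** * Smoothness of the characteristics *)

Lemma is_derive_coord {R : realType} (n : nat) (j : 'I_n) (x w : 'rV[R]_n) :
  is_derive x w (fun y : 'rV[R]_n => y 0 j) (w 0 j).
Proof.
split; first exact/diff_derivable/differentiable_coord.
apply: lim_near_cst => //; near=> h.
rewrite /= !mxE addrK -[LHS]/(h^-1 * (h * w 0 j)) mulKf //.
by near: h; exact: nbhs_dnbhs_neq.
Unshelve. all: by end_near. Qed.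

(** Polynomials of this shape contain x_0 x_1 and are stable under directional
    derivation. *)
Definition quadratic {R : realType} (a b c d : R) (x : 'rV[R]_2) : R :=
  a * (x 0 0 * x 0 1) + b * x 0 0 + c * x 0 1 + d.

Lemma differentiable_quadratic {R : realType} (a b c d : R) (x : 'rV[R]_2) :
  differentiable (quadratic a b c d) x.
Proof.
by do ![apply: differentiableD | apply: differentiableM
       | exact: differentiable_coord | exact: differentiable_cst].
Qed.

Lemma derive_quadratic {R : realType} (a b c d : R) (w x : 'rV[R]_2) :
  'D_w (quadratic a b c d) x =
  quadratic 0 (a * w 0 1) (a * w 0 0) (b * w 0 0 + c * w 0 1) x.
Proof.
have h0 := is_derive_coord 0 x w; have h1 := is_derive_coord 1 x w.
have [_ hD] := is_deriveD (is_deriveD (is_deriveD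
  (is_deriveZ a (is_deriveM h0 h1)) (is_deriveZ b h0)) (is_deriveZ c h1))
  (is_derive_cst d x w).
rewrite [LHS]hD /quadratic.
transitivity (a * (x 0 0 * w 0 1 + x 0 1 * w 0 0) + b * w 0 0 + c * w 0 1 + 0).
  by [].
ring.
Qed.

Lemma smooth_quadratic {R : realType} (a b c d : R) :
  smooth_on setT (quadratic a b c d).
Proof.
split; first exact: openT.
move=> s x _.
have [[[[a' b'] c'] d'] ->] : exists k, partials s (quadratic a b c d) =
    quadratic k.1.1.1 k.1.1.2 k.1.2 k.2.
  elim: s => [|i s [k IH]] /=; first by exists (a, b, c, d).
  eexists (_, _, _, _); apply/funext => y /=.
  by rewrite IH derive_quadratic.
split; first exact/differentiable_continuous/differentiable_quadratic.
by move=> i; exact/diff_derivable/differentiable_quadratic.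
Qed.

Lemma smooth_jet_mul {R : realType} (a : R) (w w' : unknown)
    (al al' : multi_index) :
  smooth_jet_function
    (fun p : jet_space R => a * (p (Jet w al) * p (Jet w' al'))).
Proof.
exists 2, (fun k => if k == 0 then Jet w al else Jet w' al'), setT,
  (quadratic a 0 0 0).
split; first exact: smooth_quadratic.
by move=> p _; split => //; rewrite /quadratic !mxE /= !mul0r !addr0.
Qed.

(** * The hierarchy of nonlocal symmetries *)

Theorem proposition1 (R : realType) (lam : 'I_4 -> R)
    (hlam : injective lam) (r : nat) :
  nonlocal_symmetry lam
    (fun p : jet_space R => xi2 r p * Dx x2 u p)
    (fun p : jet_space R => - (xi1 r p * Dx x1 v p)).
Proof.
have hU : rep (U_expr r) (fun p : jet_space R => xi2 r p * Dx x2 u p).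
  by apply: rep_mul => //; exact: rep_Dx rep_u.
have hV : rep (V_expr r) (fun p : jet_space R => - (xi1 r p * Dx x1 v p)).
  by apply: rep_opp; apply: rep_mul => //; exact: rep_Dx rep_v.
split.
- rewrite (_ : (fun p => _) = fun p : jet_space R =>
    1 * (p (Jet (unk_xi2 r) [ffun=> 0%N])
       * p (Jet unk_u (incr x2 [ffun=> 0%N])))); first exact: smooth_jet_mul.
  by apply/funext => p; rewrite mul1r [Dx _ _ p]Dx_jet.
- rewrite (_ : (fun p => _) = fun p : jet_space R =>
    (-1) * (p (Jet (unk_xi1 r) [ffun=> 0%N])
       * p (Jet unk_v (incr x1 [ffun=> 0%N])))); first exact: smooth_jet_mul.
  by apply/funext => p; rewrite mulN1r [Dx _ _ p]Dx_jet.
- move=> p cp; have [rp _ _ _] := cp.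
  have [L1_eq0 L2_eq0] := linearization_eq0 r hlam cp; split.
  + exact: is_derive_eq (is_derive_S lam rep_u rep_v rep_u hU hV hU rp) L1_eq0.
  + exact: is_derive_eq (is_derive_S lam rep_u rep_v rep_v hU hV hV rp) L2_eq0.
Qed.
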